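(* $F_v(3,3;J_4)\le 135$; that is, there exists a $J_4$-free graph on $135$ vertices such that every coloring of its vertices with two colors contains a monochromatic triangle.
   Context: All graphs are finite, simple and undirected. $J_4$ denotes the complete graph $K_4$ with one edge removed. A graph $G$ is $H$-free if it contains no subgraph (not necessarily induced) isomorphic to $H$. $F_v(3,3;J_4)$ is the minimum number of vertices of a $J_4$-free graph $G$ such that every $2$-coloring of $V(G)$ yields a monochromatic triangle. *)

(* Defs.v *)
From mathcomp Require Import all_boot.

Set Implicit Arguments.
Unset Strict Implicit.
Unset Printing Implicit Defensive.

Record sgraph := SGraph {
  vertex :> finType;
  adj : rel vertex;
  adj_sym : symmetric adj;
  adj_irrefl : irreflexive adj }.

Section Complete.
Variable n : nat.
Definition complete_adj : rel 'I_n := fun x y => x != y.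
Lemma complete_adj_sym : symmetric complete_adj.
Proof. by move=> x y; rewrite /complete_adj eq_sym. Qed.
Lemma complete_adj_irrefl : irreflexive complete_adj.
Proof. by move=> x; rewrite /complete_adj eqxx. Qed.
Definition complete : sgraph := SGraph complete_adj_sym complete_adj_irrefl.
End Complete.

Section DeleteEdge.
Variables (G : sgraph) (u v : G).
Definition delete_edge_adj : rel G :=
  fun x y => adj x y && ([set x; y] != [set u; v]).
Lemma delete_edge_adj_sym : symmetric delete_edge_adj.
Proof. by move=> x y; rewrite /delete_edge_adj adj_sym setUC. Qed.
Lemma delete_edge_adj_irrefl : irreflexive delete_edge_adj.
Proof. by move=> x; rewrite /delete_edge_adj adj_irrefl. Qed.
Definition delete_edge : sgraph :=
  SGraph delete_edge_adj_sym delete_edge_adj_irrefl.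
End DeleteEdge.

Definition J4 : sgraph := @delete_edge (complete 4) ord0 ord_max.

(* Not necessarily induced: edges must map to edges, non-edges are free. *)
Definition has_subgraph (H G : sgraph) : Prop :=
  exists f : H -> G, injective f /\ forall x y : H, adj x y -> adj (f x) (f y).

Definition free (H G : sgraph) : Prop := ~ has_subgraph H G.

Definition has_mono_triangle (G : sgraph) (c : G -> bool) : Prop :=
  exists x y z : G,
    [/\ adj x y, adj y z & adj x z] /\ (c x = c y /\ c y = c z).

Definition varrows33 (G : sgraph) : Prop :=
  forall c : G -> bool, has_mono_triangle c.

Definition Fv33_order (H : sgraph) (n : nat) : Prop :=
  exists G : sgraph, [/\ #|G| = n, free H G & varrows33 G].

(* F_v(3,3;H) = m. It is a relation rather than a function because the minimum
   exists only when some H-free graph has the arrowing property. *)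
Definition is_Fv33 (H : sgraph) (m : nat) : Prop :=
  Fv33_order H m /\ forall n : nat, Fv33_order H n -> m <= n.

(* Main.v *)
(* Take the Cayley graph on the semidirect product of Z_45 by Z_3 (a generator
   of Z_3 acting on Z_45 as multiplication by 16) whose triangles are the left
   translates {g, g a, g a b} for five triples with a b c = 1, two of them
   coming from elements of order 3.  Each vertex lies on 11 triangles, no edge
   lies on two triangles, and the resulting 495 triangles cannot be 2-coloured:
   backtracking over the vertices with unit propagation closes all branches. *)
From Stdlib Require Import BinNat FMapPositive Classical.
Require Import Defs.
From mathcomp Require Import all_boot.

Set Implicit Arguments.
Unset Strict Implicit.
Unset Printing Implicit Defensive.

Definition lookup (A : Type) (m : PositiveMap.t A) (i : N) : option A :=
  PositiveMap.find (N.succ_pos i) m.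

Definition store (A : Type) (m : PositiveMap.t A) (i : N) (a : A) :=
  PositiveMap.add (N.succ_pos i) a m.

Lemma lookup_store A (m : PositiveMap.t A) i a j :
  lookup (store m i a) j = if j == i then Some a else lookup m j.
Proof.
rewrite /lookup /store; case: eqP => [->|ji]; first exact: PositiveMap.gss.
apply: PositiveMap.gso => eq_ji; apply: ji.
by rewrite -(N.pos_pred_succ j) eq_ji N.pos_pred_succ.
Qed.

Definition tabulate (A : Type) (f : N -> A) (s : seq N) : PositiveMap.t A :=
  foldr (fun i m => store m i (f i)) (PositiveMap.empty A) s.

Lemma lookup_tabulate A (f : N -> A) s i a :
  lookup (tabulate f s) i = Some a -> i \in s /\ a = f i.
Proof.
elim: s => [|j s IHs] /=; first by rewrite /lookup PositiveMap.gempty.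
rewrite lookup_store inE; case: eqP => [->|_] /=; first by case=> <-.
exact: IHs.
Qed.

Definition colored (m : PositiveMap.t bool) (i : N) (b : bool) : bool :=
  if lookup m i is Some b' then b' == b else false.

(** Unit propagation. A pair already coloured [b] twice still yields an entry with colour [~~ b],
    whose conflict shows when [refute] dequeues it. *)
Definition forced (m : PositiveMap.t bool) (b : bool) (s : seq (N * N)) :=
  pmap (fun e : N * N =>
          if colored m e.1 b then Some (e.2, ~~ b)
          else if colored m e.2 b then Some (e.1, ~~ b) else None) s.

Definition incident (t : PositiveMap.t (seq (N * N))) (i : N) :=
  if lookup t i is Some s then s else [::].

(* [t] lists, for every vertex [i], the pairs completing [i] to a triangle; [m]
   is a partial colouring, [q] a queue of forced colours, and [vs] the vertices
   still available for branching.  The result [true] means that no colouring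
   extending [m] and [q] avoids monochromatic triangles. *)
Fixpoint refute (t : PositiveMap.t (seq (N * N))) (fuel : nat)
    (m : PositiveMap.t bool) (q : seq (N * bool)) (vs : seq N) : bool :=
  if fuel is fuel'.+1 then
    match q, vs with
    | (i, b) :: q', _ =>
        if lookup m i is Some b' then
          if b == b' then refute t fuel' m q' vs else true
        else
          let m' := store m i b in
          refute t fuel' m' (forced m' b (incident t i) ++ q') vs
    | [::], i :: vs' =>
        if lookup m i is Some _ then refute t fuel' m [::] vs'
        else if refute t fuel' m [:: (i, true)] vs'
             then refute t fuel' m [:: (i, false)] vs' else false
    | [::], [::] => false
    end
  else false.

Lemma forced_sound (c : N -> bool) m b s :
    (forall i b', lookup m i = Some b' -> c i = b') ->
    {in s, forall e, ~ (b = c e.1 /\ b = c e.2)} ->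
  {in forced m b s, forall l, c l.1 = l.2}.
Proof.
move=> mP sP l; rewrite mem_pmap => /mapP[[j k] /sP /= jk].
have coloredP i : colored m i b -> c i = b.
  by rewrite /colored; case E: (lookup m i) => [b'|] // /eqP <-; apply: mP.
case: ifP => [/coloredP cj [->] /= | _].
  by case: (c k) b cj jk {mP sP coloredP} => -[] // -> [].
case: ifP => // /coloredP ck [->] /=.
by case: (c j) b ck jk {mP sP coloredP} => -[] // -> [].
Qed.

(** Follow [c] through the search: every forced entry agrees with it, and at a branch the side
    taking the colour [c i] returns [false]. So does exhausted fuel, hence any fuel is sound. *)
Lemma refute_sound t (c : N -> bool) fuel m q vs :
    (forall i, {in incident t i, forall e, ~ (c i = c e.1 /\ c i = c e.2)}) ->
    (forall i b, lookup m i = Some b -> c i = b) ->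
    {in q, forall l, c l.1 = l.2} ->
  refute t fuel m q vs = false.
Proof.
move=> tP; elim: fuel m q vs => [//|fuel IH] m [|[i b] q] vs mP qP /=.
  case: vs => [//|i vs]; case: (lookup m i) => [_|]; first exact: IH.
  case ci: (c i); last rewrite (IH m [:: (i, false)]) ?if_same //.
    by rewrite IH // => l; rewrite inE => /eqP->.
  by move=> l; rewrite inE => /eqP->.
have ci : c i = b by apply: (qP (i, b)); rewrite mem_head.
have q'P : {in q, forall l, c l.1 = l.2}.
  by move=> l lq; apply: qP; rewrite inE lq orbT.
case E: (lookup m i) => [b'|]; first by rewrite -(mP _ _ E) ci eqxx; apply: IH.
have m'P j b' : lookup (store m i b) j = Some b' -> c j = b'.
  by rewrite lookup_store; case: eqP => [-> [<-]|_ /mP].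
apply: IH => // l; rewrite mem_cat => /orP[|/q'P //].
by apply: forced_sound m'P _ l; rewrite -ci; apply: tP.
Qed.

(* The number [45 * a + x] encodes the element [(a, x)] of the semidirect
   product of Z_45 by Z_3. *)
Definition sdmul (g h : N) : N :=
  (45 * ((g / 45 + h / 45) mod 3)
     + (g mod 45 + 16 ^ (g / 45) * (h mod 45)) mod 45)%num.

(* A triple with [a b c = 1] gives the three triangles [{g, g a, g c^-1}],
   [{g, g b, g a^-1}] and [{g, g c, g b^-1}] at [g], hence the three pairs
   [(a, c^-1)], [(b, a^-1)] and [(c, b^-1)]; an element [a] of order 3 gives the
   single pair [(a, a^-1)]. *)
Definition generator_pairs : seq (N * N) :=
  [:: (100, 4); (84, 65); (41, 96);
      (28, 108); (125, 17); (72, 70);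
      (1, 79); (78, 44); (116, 102);
      (15, 30); (45, 90)]%num.

Definition triangles_at (g : N) : seq (N * N) :=
  [seq (sdmul g e.1, sdmul g e.2) | e <- generator_pairs].

Definition neighbours (g : N) : seq N :=
  [seq e.1 | e <- triangles_at g] ++ [seq e.2 | e <- triangles_at g].

Definition vertices : seq N := [seq bin_of_nat i | i <- iota 0 135].

Lemma bin_of_nat_vertex (x : 'I_135) : bin_of_nat x \in vertices.
Proof. by apply: map_f; rewrite mem_iota /=. Qed.

Lemma vertex_ltn g : g \in vertices -> nat_of_bin g < 135.
Proof.
by case/mapP => i; rewrite mem_iota => /andP[_ i_lt] ->; rewrite bin_of_natK.
Qed.

Lemma neighbours_irrefl : all (fun g => g \notin neighbours g) vertices.
Proof. by vm_compute. Qed.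

Lemma neighbours_sym :
  all (fun g => all (fun h => g \in neighbours h) (neighbours g)) vertices.
Proof. by vm_compute. Qed.

(** [J4] is two triangles sharing an edge, so this bound excludes it. *)
Lemma neighbours_codegree :
  all (fun g => let ng := neighbours g in
    all (fun h => let nh := neighbours h in
      size [seq k <- ng | k \in nh] <= 1) ng) vertices.
Proof. by vm_compute. Qed.

Lemma triangles_at_closed :
  all (fun g => all (fun e => [&& e.1 \in vertices, e.2 \in vertices
                                & e.2 \in neighbours e.1])
                  (triangles_at g)) vertices.
Proof. by vm_compute. Qed.

(** Both sides of a branch get the same fuel: 1500 bounds the depth of the search, not its size. *)
Lemma refute_vertices :
  refute (tabulate triangles_at vertices) 1500 (PositiveMap.empty bool) [::] vertices.
Proof. by vm_compute. Qed.

Definition cayley_adj : rel 'I_135 :=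
  fun x y => bin_of_nat y \in neighbours (bin_of_nat x).

Lemma cayley_adj_sym : symmetric cayley_adj.
Proof.
have adjW x y : cayley_adj x y -> cayley_adj y x.
  move=> xy; have /allP/(_ _ (bin_of_nat_vertex x))/allP := neighbours_sym.
  exact.
by move=> x y; apply/idP/idP; apply: adjW.
Qed.

Lemma cayley_adj_irrefl : irreflexive cayley_adj.
Proof.
by move=> x; apply/negbTE/(allP neighbours_irrefl)/bin_of_nat_vertex.
Qed.

Definition cayley_graph : sgraph := SGraph cayley_adj_sym cayley_adj_irrefl.

Lemma cayley_J4_free : free J4 cayley_graph.
Proof.
case=> f [f_inj f_adj].
have fP (i j : 'I_4) : adj (i : J4) (j : J4) ->
    bin_of_nat (f j) \in neighbours (bin_of_nat (f i)) by apply: f_adj.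
have J4P (i j : 'I_4) : (i != j) && ([set i; j] != [set ord0; ord_max]) ->
  adj (i : J4) (j : J4) by [].
(* The missing edge joins 0 and 3, so 1 and 2 span the edge shared by the two triangles, and 0 and 3
   go to two common neighbours of its ends. *)
pose u : 'I_4 := inord 1; pose v : 'I_4 := inord 2.
have adjJ (i j : 'I_4) : i != j -> i \in [:: u; v] -> adj (i : J4) (j : J4).
  move=> ij iuv; apply: J4P; rewrite ij /=; apply/eqP => /setP/(_ i).
  rewrite !inE eqxx /=; move: iuv; rewrite !inE.
  by case/orP=> /eqP->; rewrite -!val_eqE /= !inordK.
have uv : u != v by rewrite -val_eqE /= !inordK.
have u0 : u != ord0 by rewrite -val_eqE /= inordK.
have v0 : v != ord0 by rewrite -val_eqE /= inordK.
have u3 : u != ord_max by rewrite -val_eqE /= inordK.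
have v3 : v != ord_max by rewrite -val_eqE /= inordK.
have /allP/(_ _ (bin_of_nat_vertex (f u)))/allP := neighbours_codegree.
move=> /(_ _ (fP _ _ (adjJ u v uv _))); rewrite mem_head => /(_ isT).
apply/negP; rewrite -ltnNge.
apply: (@uniq_leq_size _ [:: bin_of_nat (f ord0); bin_of_nat (f ord_max)]).
  rewrite /= inE andbT; apply/negP => /eqP.
  by move/(can_inj bin_of_natK)/val_inj/f_inj.
by move=> k; rewrite !inE mem_filter => /orP[] /eqP->;
  rewrite !fP // adjJ // !inE eqxx ?orbT.
Qed.

Lemma cayley_varrows33 : varrows33 cayley_graph.
Proof.
move=> c; apply: NNPP => no_mono.
(* From 135 on [inord] defaults to 0; [triangles_at_closed] keeps every index that matters below
   135. *)
pose dec g : cayley_graph := inord (nat_of_bin g).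
have decK g : g \in vertices -> bin_of_nat (dec g) = g.
  by move/vertex_ltn => g_lt; rewrite inordK // nat_of_binK.
have := refute_vertices; rewrite (@refute_sound _ (c \o dec)) // => i e.
  rewrite /incident; case E: (lookup _ i) => [s|//].
  have [iV ->] := lookup_tabulate E => e_tri [c1 c2]; apply: no_mono.
  have /allP/(_ _ iV)/allP/(_ _ e_tri)/and3P[V1 V2 adj12] := triangles_at_closed.
  exists (dec i), (dec e.1), (dec e.2); split; last first.
  by split; [exact: c1 | exact: etrans (esym c1) c2].
  by split; rewrite /= /cayley_adj !decK // mem_cat map_f ?orbT.
by rewrite /lookup PositiveMap.gempty.
Qed.

(** Descent to a least order; excluded middle decides whether a smaller one exists. *)
Lemma is_Fv33_exists H n : Fv33_order H n -> exists m, is_Fv33 H m /\ m <= n.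
Proof.
elim/ltn_ind: n => n IH Hn.
case: (classic (exists2 k, k < n & Fv33_order H k)) => [[k k_lt /(IH _ k_lt)]|min_n].
  by case=> m [Hm le_mk]; exists m; split=> //; apply: leq_trans le_mk (ltnW k_lt).
exists n; split=> //; split=> // k Hk; rewrite leqNgt; apply/negP => k_lt.
by apply: min_n; exists k.
Qed.

Theorem theorem7 :
  (exists m : nat, is_Fv33 J4 m /\ m <= 135) /\
  (exists G : sgraph, [/\ #|G| = 135, free J4 G & varrows33 G]).
Proof.
have order135 : Fv33_order J4 135.
  exists cayley_graph; split; first exact: card_ord.
  - exact: cayley_J4_free.
  - exact: cayley_varrows33.
by split; first exact: is_Fv33_exists.
Qed.
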